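(* Let $A\subset\mathbb N$ be a classical normal set. For any $i,j,k\in\mathbb N$ there are $a,b,c\in A$ solving the equation $ia+jb=kc$.
   Context: $\mathbb N=\{1,2,\dots\}$. A set $A\subset\mathbb N$ is classical normal if its indicator sequence $x=\mathbf 1_A\in\{0,1\}^{\mathbb N}$ is normal: for every $k\in\mathbb N$ and every word $w\in\{0,1\}^k$, $\lim_{n\to\infty}\frac1n|\{m\in\{1,\dots,n-k+1\}:\langle x_m,\dots,x_{m+k-1}\rangle=w\}|=2^{-k}$. *)

(* Defs.v *)
From HB Require Import structures.
From mathcomp Require Import all_boot all_order all_algebra.
From mathcomp Require Import all_classical all_reals all_analysis.
Set Implicit Arguments.
Unset Strict Implicit.
Unset Printing Implicit Defensive.
Import Order.TTheory GRing.Theory Num.Theory numFieldNormedType.Exports.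

(* Sequences in {0,1}^{1,2,...} are functions x : nat -> bool whose value at 0
   is never read. *)

Definition factor (x : nat -> bool) (m k : nat) : seq bool :=
  [seq x l | l <- iota m k].

(* The range iota 1 (n.+1 - k) is {1, ..., n - k + 1}, empty when n < k. *)
Definition occurrences (x : nat -> bool) (k : nat) (w : k.-tuple bool)
    (n : nat) : nat :=
  count (fun m => factor x m k == w :> seq bool) (iota 1 (n.+1 - k)).

Local Open Scope classical_set_scope.
Local Open Scope ring_scope.

Definition normal_sequence (R : realType) (x : nat -> bool) : Prop :=
  forall (k : nat), (0 < k)%N -> forall w : k.-tuple bool,
    ((occurrences x w n)%:R / n%:R : R) @[n --> \oo] --> (2 ^- k : R).

Definition indicator (A : set nat) : nat -> bool := fun m => m \in A.

Definition classical_normal (R : realType) (A : set nat) : Prop :=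
  normal_sequence R (indicator A).

(* Main.v *)
From Pilot Require Import Defs.
From HB Require Import structures.
From mathcomp Require Import all_boot all_order all_algebra.
From mathcomp Require Import all_classical all_reals all_analysis.
From mathcomp Require Import zify.
Set Implicit Arguments.
Unset Strict Implicit.
Unset Printing Implicit Defensive.
Import Order.TTheory GRing.Theory Num.Theory numFieldNormedType.Exports.
Local Open Scope classical_set_scope.

(** Let x be the indicator of A, and let B be the set of b with kb in A.  It is
    enough to find a, b in B with ia + jb in A, since then
    i(ka) + j(kb) = k(ia + jb) is a solution.  Suppose that there are none.
    Two estimates on densities then contradict each other.

    The set B is not too thin: among any k consecutive integers one is a
    multiple of k, so every occurrence of the word 1^k in x exhibits an element
    of B, and each element of B is exhibited by at most k occurrences.  As 1^k
    has frequency 2^-k in x, the lower density of B is at least 2^-k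
    ([normal_multiples_lower_density]).

    On the other hand, fix r elements a_1, ..., a_r of B.  For each b in B, x
    vanishes at the r distinct places jb + i a_t.  The places m such that x
    vanishes at all the m + i a_t have density 2^-r among all integers, because
    normality gives the frequency of any set of words of a given length; hence
    at most about (j + 1) 2^-r N of them have the form jb with b <= N
    ([normal_avoidance_upper_density]).  So B has upper density at most
    (j + 1) 2^-r.  Since B is infinite, r is arbitrary, and a large r gives the
    contradiction.  *)

(* The bare name would denote an operation on intervals. *)
Local Notation factor := Pilot.Defs.factor.

Lemma nth_factor (x : nat -> bool) (m k t : nat) :
  (t < k)%N -> nth false (factor x m k) t = x (m + t)%N.
Proof. by move=> tk; rewrite (nth_map 0%N) ?size_iota ?nth_iota. Qed.

Lemma size_factor (x : nat -> bool) (m k : nat) : size (factor x m k) = k.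
Proof. by rewrite size_map size_iota. Qed.

Lemma count_factor (x : nat -> bool) (k : nat) (p : pred (seq bool))
    (s : seq nat) :
  count (fun m => p (factor x m k)) s =
  (\sum_(w : k.-tuple bool | p w)
     count (fun m => factor x m k == w :> seq bool) s)%N.
Proof.
elim: s => [|m s IHs] /=; first by rewrite big1.
rewrite big_split /= -IHs; congr (_ + _)%N.
(* Exactly one word, the one read at m, contributes to the sum. *)
pose u : k.-tuple bool := Tuple (introT eqP (size_factor x m k)).
have uE (w : k.-tuple bool) : (factor x m k == w :> seq bool) = (w == u).
  by rewrite eq_sym.
under eq_bigr do rewrite uE.
rewrite -[factor x m k]/(tval u); case: (boolP (p u)) => [pu|npu].
  by rewrite (bigD1 u) //= eqxx big1 // => w /andP[_ /negPf ->].
by rewrite big1 // => w pw; case: eqP pw npu => // -> ->.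
Qed.

Local Open Scope ring_scope.

(** Frequencies are finitely additive, and each of the words of length k that
    satisfy p contributes 2^-k. *)
Lemma normal_pattern_frequency (R : realType) (x : nat -> bool) (k : nat)
    (p : pred (seq bool)) :
  normal_sequence R x -> (0 < k)%N ->
  (count (fun m => p (factor x m k)) (iota 1 (n.+1 - k)))%:R / n%:R
    @[n --> \oo] --> (#|[pred w : k.-tuple bool | p w]|%:R / 2 ^+ k : R).
Proof.
move=> xN k0.
rewrite -sumr_const mulr_suml.
under eq_cvg do rewrite count_factor natr_sum mulr_suml.
under eq_bigr do rewrite mul1r.
by apply: cvg_big => [|w _]; [exact: add_continuous|exact: xN].
Qed.

Local Close Scope ring_scope.

(** A word vanishing on s is a function supported off s, and at most K - |s|
    indices lie off s; the factor on the left avoids a subtraction. *)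
Lemma card_vanishing_words (K : nat) (s : seq nat) :
  uniq s -> all (fun t => t < K)%N s ->
  (2 ^ size s *
     #|[pred w : K.-tuple bool | all (fun t => ~~ nth false w t) s]|
     <= 2 ^ K)%N.
Proof.
move=> us sK; pose D := [pred t : 'I_K | val t \notin s].
have szD : (size s + #|D| <= K)%N.
  rewrite -[leqRHS]card_ord -(cardC D) addnC leq_add2l cardE -(size_map val).
  apply: uniq_leq_size => // t ts; have tK := allP sK _ ts.
  by apply/mapP; exists (Ordinal tK); rewrite // mem_enum !inE /= negbK.
apply: leq_trans (leq_pexp2l _ szD) => //; rewrite expnD leq_mul2l.
pose f (w : K.-tuple bool) := [ffun t : 'I_K => tnth w t].
have finj : injective f.
  by move=> u v /ffunP uv; apply: eq_from_tnth => t; have := uv t; rewrite !ffunE.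
rewrite -(fintype.card_image finj) -card_bool -(card_pffun_on false D predT).
apply/orP; right; apply/subset_leq_card/fintype.subsetP => _ /fintype.imageP[w ws ->].
apply/pffun_onP; split => //; apply/fintype.subsetP => t; rewrite !inE ffunE => wt.
apply: contraTN wt => ts; rewrite eqbF_neg negbK (tnth_nth false).
by move: ws; rewrite inE => /allP; apply.
Qed.

(** If x is constantly 1 on m, ..., m + k - 1, then kb, the first multiple of k
    not below m, lies in this window, so m = kb - r with r < k and x (kb) = 1:
    there are at most k occurrences for each such b. *)
Lemma occurrences_ones_le (x : nat -> bool) (k N : nat) : (0 < k)%N ->
  (occurrences x (nseq_tuple k true) (k * N)
     <= count (fun b => x (k * b)) (iota 1 N) * k)%N.
Proof.
move=> k0; rewrite /occurrences -[X in (_ <= _ * X)%N](size_iota 0) -!size_filter.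
rewrite -(size_allpairs (fun b r => k * b - r)%N).
apply: uniq_leq_size => [|m]; first by rewrite filter_uniq ?iota_uniq.
rewrite mem_filter mem_iota => /andP[/eqP ones mN].
(* The quotient m / k rounded up. *)
pose b := ((m + k.-1) %/ k)%N.
have bk : (m <= k * b < m + k)%N.
  have := divn_eq (m + k.-1) k; have := ltn_pmod (m + k.-1) k0.
  by rewrite -/b mulnC; lia.
apply/allpairsP; exists (b, k * b - m)%N => /=; split; last by lia.
  rewrite mem_filter mem_iota; apply/andP; split; last by nia.
  have lk : (k * b - m < k)%N by lia.
  have := nth_factor x m lk; rewrite ones nth_nseq lk => /esym.
  by rewrite subnKC //; case/andP: bk.
by rewrite mem_iota; lia.
Qed.

(** The lower density is at least 2^-k by [occurrences_ones_le]; half of it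
    leaves room to pass from the limit to all large N. *)
Lemma normal_multiples_lower_density (R : realType) (x : nat -> bool)
    (k : nat) : normal_sequence R x -> (0 < k)%N ->
  \forall N \near \oo,
    (N <= 2 ^ k.+1 * count (fun b => x (k * b)) (iota 1 N))%N.
Proof.
move=> xN k0.
have lim := cvg_comp _ _ (cvg_mulnl _ k0) (xN k k0 (nseq_tuple k true)).
have half : (2 ^- k.+1 < 2 ^- k :> R)%R.
  by rewrite ltf_pV2 ?posrE ?exprn_gt0 // exprS ltr_pMl ?exprn_gt0 ?ltr1n.
near=> N.
have N0 : (0 < N)%N by near: N; exact: nbhs_infty_gt.
have : (2 ^- k.+1
  < (occurrences x (nseq_tuple k true) (k * N))%:R / (k * N)%:R :> R)%R.
  by near: N; exact: (cvgr_gt _ lim _ half).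
have kN0 : (0 < k * N)%N by rewrite muln_gt0 k0.
rewrite ltr_pdivlMr ?ltr0n // mulrC ltr_pdivrMr ?exprn_gt0 //.
rewrite -natrX -natrM ltr_nat => /ltnW lb.
rewrite -(leq_pmul2l k0) (leq_trans lb) //.
rewrite mulnC mulnCA leq_mul2l [(k * count _ _)%N]mulnC.
by rewrite occurrences_ones_le ?orbT.
Unshelve. all: by end_near. Qed.

(** The bound counts all the m <= jN with x (m + t) = 0 for every t in s, and
    not only the multiples of j.  A window of (j + 1)N places contains every m <= jN
    together with the word of length K that starts there, once N > K.  The
    limit is at most (j + 1) 2^-|s|; the factor 2 leaves room to pass to all
    large N. *)
Lemma normal_avoidance_upper_density (R : realType) (x : nat -> bool)
    (j : nat) (s : seq nat) :
  normal_sequence R x -> (0 < j)%N -> uniq s ->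
  \forall N \near \oo,
    (2 ^ size s *
       count (fun b => all (fun t => ~~ x (j * b + t)) s) (iota 1 N)
     <= 2 * (j.+1 * N))%N.
Proof.
move=> xN j0 us.
pose K := (\max_(t <- s) t).+1.
have sK : all (fun t => t < K)%N s.
  by apply/allP => t ts; rewrite ltnS; exact: leq_bigmax_seq.
pose p (w : seq bool) := all (fun t => ~~ nth false w t) s.
have lim := cvg_comp _ _ (cvg_mulnl _ (ltn0Sn j))
  (normal_pattern_frequency (k := K) (p := p) xN (ltn0Sn _)).
set l := (_ / 2 ^+ K)%R in lim.
have lub : (l < 2 / 2 ^+ size s)%R.
  apply: (@le_lt_trans _ _ (1 / 2 ^+ size s)%R).
    rewrite ler_pdivrMr ?exprn_gt0 // mulrAC ler_pdivlMr ?exprn_gt0 // mul1r.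
    by rewrite -!natrX -natrM ler_nat mulnC card_vanishing_words.
  by rewrite ltr_pM2r ?invr_gt0 ?exprn_gt0 ?ltr1n.
near=> N.
have KN : (K < N)%N by near: N; exact: nbhs_infty_gt.
have : ((count (fun m => p (factor x m K)) (iota 1 ((j.+1 * N).+1 - K)))%:R
          / (j.+1 * N)%:R < 2 / 2 ^+ size s :> R)%R.
  by near: N; exact: (cvgr_lt _ lim _ lub).
have jN0 : (0 < j.+1 * N)%N by rewrite muln_gt0 (leq_trans _ KN).
rewrite ltr_pdivrMr ?ltr0n // mulrAC ltr_pdivlMr ?exprn_gt0 // -natrX -!natrM.
rewrite ltr_nat mulnC => /ltnW; apply: leq_trans.
rewrite leq_mul2l; apply/orP; right.
rewrite -!size_filter -(size_map (muln j)); apply: uniq_leq_size.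
  rewrite map_inj_uniq ?filter_uniq ?iota_uniq // => a b /eqP.
  by rewrite eqn_pmul2l // => /eqP.
move=> _ /mapP[b + ->]; rewrite !mem_filter !mem_iota => /andP[zb bN].
apply/andP; split; last by nia.
apply/allP => t ts; rewrite nth_factor; last exact: (allP sK).
exact: (allP zb).
Unshelve. all: by end_near. Qed.

Theorem corollary7p19 (R : realType) (A : set nat)
    (A_pos : A `<=` [set n | (0 < n)%N]) (A_normal : classical_normal R A)
    (i j k : nat) (i_pos : (0 < i)%N) (j_pos : (0 < j)%N) (k_pos : (0 < k)%N) :
  exists a b c : nat, [/\ A a, A b, A c & (i * a + j * b = k * c)%N].
Proof.
apply: contrapT => nosol; set x := indicator A.
have xA n : x n -> A n by rewrite /x /indicator inE.
have avoid a b : x (k * a)%N -> x (k * b)%N -> ~~ x (j * b + i * a)%N.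
  move=> /xA Aa /xA Ab; apply/negP => /xA Ac; apply: nosol.
  by exists (k * a)%N, (k * b)%N, (j * b + i * a)%N; split=> //; lia.
have lower := normal_multiples_lower_density A_normal k_pos.
(* This makes 2 ^ r exceed 2 (j + 1) 2 ^ (k + 1), the ratio of the bounds. *)
pose r := (k.+1 + j.+2)%N.
have [S [uS Sx szS]] : exists S, [/\ uniq S, all (fun a => x (k * a)%N) S &
    (r <= size S)%N].
  have [N [rN]] := filter_ex (filterI (nbhs_infty_ge (2 ^ k.+1 * r)%N) lower).
  move=> Nlow; exists [seq a <- iota 1 N | x (k * a)%N].
  rewrite filter_uniq ?iota_uniq ?filter_all; split=> //.
  by rewrite size_filter -(@leq_pmul2l (2 ^ k.+1)) ?expn_gt0 // (leq_trans rN).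
have uiS : uniq [seq (i * a)%N | a <- S].
  by rewrite map_inj_uniq // => a b /eqP; rewrite eqn_pmul2l // => /eqP.
have upper := normal_avoidance_upper_density A_normal j_pos uiS.
have [N [N0 [Nlow Nup]]] :=
  filter_ex (filterI (nbhs_infty_gt 0%N) (filterI lower upper)).
move: Nlow Nup; rewrite /= -/x size_map.
set C := count _ _; set C' := count _ _ => Nlow Nup.
have CC' : (C <= C')%N.
  apply: sub_count => b xb; rewrite all_map; apply/allP => a aS /=.
  exact: avoid (allP Sx _ aS) xb.
have rC : (2 ^ r * C <= 2 * (j.+1 * N))%N.
  by apply: leq_trans Nup; rewrite leq_mul ?leq_pexp2l.
have C0 : (0 < C)%N.
  by rewrite lt0n; apply: contraL Nlow => /eqP ->; rewrite muln0 -ltnNge.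
have : (2 ^ j.+1 <= j.+1)%N.
  rewrite -(@leq_pmul2l (2 * (2 ^ k.+1 * C))) ?muln_gt0 ?expn_gt0 //=.
  have : (2 * (j.+1 * N) <= 2 * (j.+1 * (2 ^ k.+1 * C)))%N.
    by rewrite !leq_mul2l Nlow !orbT.
  move: rC; rewrite /r expnD [(2 ^ j.+2)%N]expnS; nia.
by rewrite leqNgt ltn_expl.
Qed.
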